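(* Let $G$ be a second countable locally compact group and $\Gamma\subseteq G$ a closed subgroup, with left Haar measures $\mu_G,\mu_\Gamma$, and with Borel section $\gamma\colon\Gamma\backslash G\to G$ and measure $\mu_{\Gamma\backslash G}$ as described in the context. The mapping $$T\colon(\Gamma\times\Gamma\backslash G,\ d\mu_\Gamma\otimes d\mu_{\Gamma\backslash G})\to(G,\ d\mu_G),\qquad T(\xi,\Gamma x)=\xi\,\gamma(\Gamma x),$$ is a measure space isomorphism.
   Context: $G$ and $\Gamma$ need not be abelian; $\Gamma\backslash G$ is the space of right cosets. Spaces carry their Borel $\sigma$-algebras. A Borel section $\tau\colon G/\Gamma\to G$ is fixed: a Borel map with $\tau(x\Gamma)\in x\Gamma$, such that $\tau(K)$ has compact closure in $G$ for every compact $K\subseteq G/\Gamma$. Then $\gamma\colon\Gamma\backslash G\to G$ is the Borel section $\gamma(\Gamma x)=[\tau(x^{-1}\Gamma)]^{-1}$. $\mu_{\Gamma\backslash G}$ is the unique positive regular Borel measure on $\Gamma\backslash G$ satisfying $$\int_Gf(x)\,d\mu_G(x)=\int_{\Gamma\backslash G}\int_\Gamma f(\xi\gamma(\Gamma x))\,d\mu_\Gamma(\xi)\,d\mu_{\Gamma\backslash G}(\Gamma x)\quad\text{for all }f\in L^1(G).$$ A measure space isomorphism is a measurable bijection with measurable inverse that carries one measure to the other. *)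

(* Defs.v *)
From HB Require Import structures.
From mathcomp Require Import all_boot all_order all_algebra.
From mathcomp Require Import all_classical all_reals all_analysis.

Set Implicit Arguments.
Unset Strict Implicit.
Unset Printing Implicit Defensive.

Import numFieldNormedType.Exports.

Local Open Scope ring_scope.
Local Open Scope classical_set_scope.
Local Open Scope ereal_scope.
Local Open Scope quotient_scope.
Local Open Scope group_scope.

HB.mixin Record isTopologicalGroup G & PointedTopological G & Group G := {
  mulg_continuous : continuous (fun xy : G * G => xy.1 * xy.2) ;
  invg_continuous : continuous (fun x : G => x^-1)
}.

(* [measurableType] is pointed, hence the pointed topology; as a group is
   inhabited, this is no restriction, and the point is never used. *)
#[short(type="topologicalGroupType")]
HB.structure Definition TopologicalGroup :=
  {G of PointedTopological G & Group G & isTopologicalGroup G}.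

Notation borel T := (g_sigma_algebraType (@open T)).

Section measures.
Context {R : realType}.

Definition regular_borel (T : ptopologicalType)
    (mu : {measure set (borel T) -> \bar R}) : Prop :=
  [/\ forall K : set T, compact K -> mu K < +oo,
      forall A : set (borel T), measurable A ->
        mu A = ereal_inf [set mu U | U in [set U : set T | open U /\ A `<=` U]]
    & forall U : set T, open U ->
        mu U =
          ereal_sup [set mu K | K in [set K : set T | compact K /\ K `<=` U]]].

Definition left_haar (H : topologicalGroupType)
    (mu : {measure set (borel H) -> \bar R}) : Prop :=
  [/\ regular_borel mu,
      mu [set: H] != 0%E
    & forall (h : H) (A : set (borel H)), measurable A ->
        mu [set h * x | x in (A : set H)] = mu A].

Definition measure_space_iso d1 d2 (T1 : measurableType d1)
    (T2 : measurableType d2) (m1 : set T1 -> \bar R) (m2 : set T2 -> \bar R)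
    (f : T1 -> T2) : Prop :=
  [/\ measurable_fun [set: T1] f,
      exists g : T2 -> T1,
        [/\ cancel f g, cancel g f & measurable_fun [set: T2] g]
    & forall A : set T2, measurable A -> pushforward m1 f A = m2 A].

End measures.

Record closedSubgroup (G : topologicalGroupType) := ClosedSubgroup {
  csg_set :> set G;
  csg_group : group_closed (fun x : G => x \in csg_set);
  csg_closed : closed csg_set
}.

Section subgroup.
Context {G : topologicalGroupType} (Gam : closedSubgroup G).

(* The group [Gam] on its own, with the subspace topology. *)
Definition subgroup : Type := set_type Gam.

HB.instance Definition _ := SubChoice.on subgroup.
HB.instance Definition _ := Topological.copy subgroup (set_type Gam).
HB.instance Definition _ := SubChoice_isSubGroup.Build G
  (fun x : G => x \in (Gam : set G)) subgroup (csg_group Gam).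
HB.instance Definition _ := isPointed.Build subgroup (1 : subgroup).

Let val_continuous : continuous (val : subgroup -> G).
Proof. exact: initial_continuous. Qed.

Let subgroup_mulg_continuous :
  continuous (fun xy : subgroup * subgroup => xy.1 * xy.2).
Proof.
apply: (@continuous_comp_initial subgroup _ _ val) => xy /=.
rewrite (_ : _ \o _ = (fun ab : G * G => ab.1 * ab.2) \o
    (fun xy : subgroup * subgroup => (val xy.1, val xy.2))); last first.
  by apply/funext => -[x y].
apply: continuous_comp; last exact: mulg_continuous.
apply: cvg_pair => /=.
- exact: (continuous_comp cvg_fst (@val_continuous _)).
- exact: (continuous_comp cvg_snd (@val_continuous _)).
Qed.

Let subgroup_invg_continuous : continuous (fun x : subgroup => x^-1).
Proof.
apply: (@continuous_comp_initial subgroup _ _ val) => x /=.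
rewrite (_ : _ \o _ = (fun a : G => a^-1) \o (val : subgroup -> G)) //.
apply: continuous_comp; [exact: val_continuous | exact: invg_continuous].
Qed.

HB.instance Definition _ := isTopologicalGroup.Build subgroup
  subgroup_mulg_continuous subgroup_invg_continuous.

(* x Gam = y Gam *)
Definition left_coset_eq (x y : G) : bool := x^-1 * y \in (Gam : set G).

(* Gam x = Gam y *)
Definition right_coset_eq (x y : G) : bool := x * y^-1 \in (Gam : set G).

Let csg_groupM := group_closedM (csg_group Gam).
Let csg_groupV := group_closedV (csg_group Gam).

Lemma left_coset_eq_equiv : equiv_class_of left_coset_eq.
Proof.
rewrite /left_coset_eq; split=> [x | x y | y x z xy yz].
- by rewrite mulVg (csg_group Gam).1.
- by apply/idP/idP => /csg_groupV; rewrite invgM invgK.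
- by rewrite -[z](mulVKg y) mulgA; exact: csg_groupM.
Qed.

Lemma right_coset_eq_equiv : equiv_class_of right_coset_eq.
Proof.
rewrite /right_coset_eq; split=> [x | x y | y x z xy yz].
- by rewrite mulgV (csg_group Gam).1.
- by apply/idP/idP => /csg_groupV; rewrite invgM invgK.
- by rewrite -[x](mulgVK y) -mulgA; exact: csg_groupM.
Qed.

Canonical left_coset_equiv := EquivRelPack left_coset_eq_equiv.
Canonical right_coset_equiv := EquivRelPack right_coset_eq_equiv.

(* G / Gam and Gam \ G, with the quotient topology *)
Definition left_cosets := quotient_topology {eq_quot left_coset_equiv}.
Definition right_cosets := quotient_topology {eq_quot right_coset_equiv}.

HB.instance Definition _ := PointedTopological.on left_cosets.
HB.instance Definition _ := Quotient.on left_cosets.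
HB.instance Definition _ := PointedTopological.on right_cosets.
HB.instance Definition _ := Quotient.on right_cosets.

Definition left_coset (x : G) : left_cosets := \pi_left_cosets x.
Definition right_coset (x : G) : right_cosets := \pi_right_cosets x.

Definition borel_section (tau : left_cosets -> G) : Prop :=
  [/\ measurable_fun [set: borel left_cosets] (tau : _ -> borel G),
      forall x : G, [set x * s | s in (Gam : set G)] (tau (left_coset x))
    & forall K : set left_cosets, compact K -> compact (closure (tau @` K))].

(* gamma (Gam x) = (tau (x^-1 Gam))^-1; by [right_sectionE] below, this does
   not depend on the representative x. *)
Definition right_section (tau : left_cosets -> G) (q : right_cosets) : G :=
  (tau (left_coset (repr q)^-1))^-1.

Lemma right_sectionE tau x :
  right_section tau (right_coset x) = (tau (left_coset x^-1))^-1.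
Proof.
rewrite /right_section; congr (tau _)^-1; apply/eqmodP => /=.
rewrite /left_coset_eq invgK.
by have /eqmodP := reprK (right_coset x).
Qed.

End subgroup.

(* Main.v *)
Require Import Defs.
From HB Require Import structures.
From mathcomp Require Import all_boot all_order all_algebra.
From mathcomp Require Import all_classical all_reals all_analysis.
Import numFieldNormedType.Exports.

(** Every [x] of [G] factors as [x = xi * gamma (Gam x)] for exactly one [xi] in
    [Gam], because the section [gamma] picks a point of the coset [Gam x].  So
    the map [(xi, q) |-> xi * gamma q] is a bijection, with inverse
    [x |-> (x * (gamma (Gam x))^-1, Gam x)].

    Both directions are built from the quotient map, [gamma], inversion and
    multiplication.  The one delicate point is multiplication: the product of
    the Borel sigma-algebras has to contain the preimages of open sets of [G]
    under [G * G -> G], which are open in [G * G].  Second countability gives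
    this ([open_prod_measurable]), since an open set of the product is then a
    countable union of open rectangles.

    For the measures, let [A] be a Borel set with [mu_G A] finite, and apply the
    disintegration formula that characterizes [mu_Q] to the indicator of [A].
    The inner integral at [q] is the [mu_Gam]-measure of the [q]-section of the
    preimage of [A], and Tonelli's theorem identifies the iterated integral
    with the product measure of that preimage.  Tonelli's theorem
    ([product_measure1_ysection]) and the passage to sets of infinite measure
    ([preimage_measure_eq_sigma_finite]) need sigma-finiteness of the three
    measures.  As [G] is a countable union of compact sets
    ([countable_compact_cover]), so are the closed subgroup (by intersecting)
    and the quotient (by projecting), and regular measures are finite on
    compact sets.  These compact sets also have to be Borel; in the quotient
    this rests on [Gam * K] being closed for [K] compact
    ([closed_right_coset]). *)
Local Open Scope ring_scope.
Local Open Scope classical_set_scope.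
Local Open Scope ereal_scope.
Local Open Scope group_scope.

(** * Product and sigma-finite measures *)

(** The product measure lemmas read sigma-finiteness off the structure carried
    by the measure, whereas here it is a derived fact about a given measure. *)
Definition sigma_finite_pack (R : realType) d (T : measurableType d)
    (m : {measure set T -> \bar R}) (m_fin : sigma_finite [set: T] m) :
    {sigma_finite_measure set T -> \bar R} :=
  HB.pack (Measure.sort m) (isSigmaFinite.Build _ _ _ (Measure.sort m) m_fin)
    (isSFinite.Build _ _ _ (Measure.sort m)
      (sfinite_measure_sigma_finite m_fin)).

(** Tonelli's theorem for the measure of a set: integrating the sections along
    the second factor also gives a measure with the right value on rectangles,
    and sigma-finiteness makes such a measure unique. *)
Lemma product_measure1_ysection (R : realType) d1 d2 (T1 : measurableType d1)
    (T2 : measurableType d2) (m1 : {measure set T1 -> \bar R})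
    (m2 : {measure set T2 -> \bar R}) (A : set (T1 * T2)) :
  sigma_finite [set: T1] m1 -> sigma_finite [set: T2] m2 -> measurable A ->
  (m1 \x m2)%E A = \int[m2]_y m1 (ysection A y).
Proof.
move=> m1_fin m2_fin mA.
pose k1 := sigma_finite_pack _ _ _ m1 m1_fin.
pose k2 := sigma_finite_pack _ _ _ m2 m2_fin.
apply: (@product_measure_unique _ _ _ _ _ k1 k2 (k1 \x^ k2)%E _ A mA).
by move=> X Y mX mY; exact: product_measure2E.
Qed.

(** Integrability restricts the disintegration formula to sets of finite
    measure; exhausting a set by an increasing sequence of such sets and using
    continuity from below of both measures lifts this restriction. *)
Lemma preimage_measure_eq_sigma_finite (R : realType) d1 d2
    (T1 : measurableType d1) (T2 : measurableType d2)
    (m1 : {measure set T1 -> \bar R}) (m2 : {measure set T2 -> \bar R})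
    (f : T1 -> T2) :
  measurable_fun [set: T1] f -> sigma_finite [set: T2] m2 ->
  (forall A, measurable A -> (m2 A < +oo)%E -> m1 (f @^-1` A) = m2 A) ->
  forall A, measurable A -> m1 (f @^-1` A) = m2 A.
Proof.
move=> mf /sigma_finiteP[F [FT F_nd F_fin]] m12 A mA.
have mpre B : measurable B -> measurable (f @^-1` B).
  by move=> mB; rewrite -[X in measurable X]setTI; exact: mf.
pose B n := A `&` F n.
have mB n : measurable (B n) by apply: measurableI => //; exact: (F_fin n).1.
have B_nd : nondecreasing_seq B.
  by move=> i j /F_nd /subsetPset Fij; apply/subsetPset; exact: setIS.
have AE : A = \bigcup_n B n by rewrite -setI_bigcupr -FT setIT.
have cvg_m2 : m2 (B n) @[n --> \oo] --> m2 A.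
  rewrite [in X in _ --> X]AE; apply: nondecreasing_cvg_mu => //.
  by rewrite -AE.
have cvg_m1 : m1 (f @^-1` B n) @[n --> \oo] --> m1 (f @^-1` A).
  rewrite [in X in _ --> X]AE preimage_bigcup; apply: nondecreasing_cvg_mu.
  - by move=> n; exact: mpre.
  - by rewrite -preimage_bigcup -AE; exact: mpre.
  - move=> i j /B_nd /subsetPset Bij; apply/subsetPset.
    exact: preimage_subset.
apply: (cvg_unique _ cvg_m1) => //.
have -> : (fun n => m1 (f @^-1` B n)) = m2 \o B; last exact: cvg_m2.
apply/funext => n /=; apply: m12 => //.
apply: (Order.POrderTheory.le_lt_trans _ (F_fin n).2).
by apply: le_measure; rewrite ?inE //; [exact: (F_fin n).1|exact: subIsetr].
Qed.

(** * Borel sets of second countable and of locally compact spaces *)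

Lemma closed_measurable_borel (T : ptopologicalType) (C : set T) :
  closed C -> measurable (C : set (borel T)).
Proof.
move=> cC; rewrite -(setCK C); apply: measurableC.
by apply: sub_sigma_algebra; exact: closed_openC.
Qed.

Lemma measurable_fun_borel d (S : measurableType d) (T : ptopologicalType)
    (f : S -> T) :
  (forall U : set T, open U -> measurable (f @^-1` U)) ->
  measurable_fun [set: S] (f : S -> borel T).
Proof.
move=> mf; apply: (@measurability _ _ S (borel T) setT f (@open T)) => //.
move=> _ [U oU <-].
by rewrite setTI; exact: mf.
Qed.

Lemma continuous_measurable_borel (S T : ptopologicalType) (f : S -> T) :
  continuous f -> measurable_fun [set: borel S] (f : borel S -> borel T).
Proof.
move=> /continuousP cf; apply: measurable_fun_borel => U oU.
by apply: sub_sigma_algebra; exact: cf.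
Qed.

(** Around each of its points, an open set of the product contains a rectangle
    of basic open sets; there are only countably many of those. *)
Lemma open_prod_measurable (X Y : ptopologicalType) (W : set (X * Y)) :
  @second_countable X -> @second_countable Y -> open W ->
  measurable (W : set (borel X * borel Y)).
Proof.
move=> [B cB [B_open B_basis]] [C cC [C_open C_basis]] oW.
pose D := [set UV : set X * set Y | [/\ B UV.1, C UV.2 & UV.1 `*` UV.2 `<=` W]].
have -> : W = \bigcup_(UV in D) (UV.1 `*` UV.2).
  apply/seteqP; split => [[x y] Wxy|p [UV [_ _ +] UVp]]; last exact.
  have [[U V] [/= nU nV] UVW] : nbhs (x, y) W by exact: open_nbhs_nbhs.
  have [U' [BU' U'x] U'U] := B_basis x U nU.
  have [V' [CV' V'y] V'V] := C_basis y V nV.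
  by exists (U', V') => //; split=> // -[a b] [/= /U'U Ua /V'V Vb]; exact: UVW.
have /pfcard_geP[->|[e]] : countable D.
  apply: (@sub_countable _ _ _ (B `*` C)); last exact: countableX.
  by apply: subset_card_le => UV [].
  by rewrite bigcup_set0.
rewrite -(image_eq e) bigcup_image.
apply: bigcupT_measurable => n.
have [/B_open oU /C_open oV _] := @funS _ _ _ _ e n Logic.I.
by apply: measurableX; exact: sub_sigma_algebra.
Qed.

(** The precompact members of a countable basis still cover the space, since
    every point has a compact closed neighbourhood; take their closures. *)
Lemma countable_compact_cover (T : topologicalType) :
  @second_countable T -> locally_compact [set: T] ->
  exists K : (set T)^nat,
    [/\ [set: T] = \bigcup_n K n, forall n, compact (K n)
      & forall n, closed (K n)].
Proof.
move=> [B cB [B_open B_basis]] lcT.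
pose C := [set U | B U /\ precompact U].
have cC : countable C.
  by apply: (@sub_countable _ _ _ B) => //; apply: subset_card_le => U [].
have C_cover x : exists2 U, C U & U x.
  have [K nK [cK clK]] := lcT x Logic.I; rewrite withinET in nK.
  have [U [BU Ux] UK] := B_basis x K nK.
  by exists U => //; split=> //; exists K.
move/pfcard_geP : cC => [C0|[f]].
  exists (fun=> set0); split => *; [|exact: compact0|exact: closed0].
  by apply/seteqP; split => // x _; have [U] := C_cover x; rewrite C0.
exists (closure \o f); split => [|n|n] /=; last exact: closed_closure.
- apply/seteqP; split => // x _; have [U CU Ux] := C_cover x.
  have [n _ fn] := @surj _ _ _ _ f U CU; exists n => //.
  by apply: subset_closure; rewrite fn.
- by rewrite -precompactE; have [] := @funS _ _ _ _ f n Logic.I.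
Qed.

Lemma compact_cover_sigma_finite (R : realType) (T : ptopologicalType)
    (mu : {measure set (borel T) -> \bar R}) (K : (set T)^nat) :
  regular_borel mu -> [set: T] = \bigcup_n K n ->
  (forall n, compact (K n)) -> (forall n, closed (K n)) ->
  sigma_finite [set: borel T] mu.
Proof.
move=> [mu_fin _ _] KT cK clK; exists K => // n; split; last exact: mu_fin.
exact: closed_measurable_borel.
Qed.

(** * Compact sets in a closed subgroup and in its coset space *)

Section subgroup_cosets.
Context {G : topologicalGroupType} (Gam : closedSubgroup G).

Lemma subgroup_val_continuous : continuous (val : subgroup Gam -> G).
Proof. exact: initial_continuous. Qed.

(** A filter on the subgroup is pushed to [G], where it clusters at a point of
    the compact set [K `&` Gam]; the subspace topology brings that point
    back. *)
Lemma compact_subgroup (K : set G) :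
  compact K -> compact (val @^-1` K : set (subgroup Gam)).
Proof.
move=> cK F FF FK.
have FvF : ProperFilter (val @ F) by exact: fmap_proper_filter.
have cKG : compact (K `&` Gam).
  by apply: compact_closedI cK _; exact: csg_closed.
have FKG : (val @ F) (K `&` (Gam : set G)).
  suff : F (val @^-1` (K `&` (Gam : set G))) by [].
  apply: (@filterS _ F _ (val @^-1` K)) => // x Kx.
  by split => //; exact: set_mem (valP x).
have [p [[Kp Gp] clp]] := cKG _ FvF FKG.
pose q : subgroup Gam := exist _ p (mem_set Gp).
exists q; split=> // A U FA [_ [[V oV <-] /= Vq VU]].
have nV : nbhs p V by exact: open_nbhs_nbhs.
have FvA : (val @ F) (val @` A).
  suff : F (val @^-1` (val @` A)) by [].
  by apply: (@filterS _ F _ A) => // a Aa; exists a.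
have [_ [[a Aa <-] Va]] := clp _ _ FvA nV.
by exists a; split => //; exact: VU.
Qed.

Lemma right_coset_continuous : continuous (right_coset Gam).
Proof. exact: pi_continuous. Qed.

Lemma left_coset_continuous : continuous (left_coset Gam).
Proof. exact: pi_continuous. Qed.

Lemma right_cosetP (x y : G) :
  reflect (right_coset Gam x = right_coset Gam y) (x * y^-1 \in (Gam : set G)).
Proof. by apply: (iffP idP) => [xy|/eqmodP //]; apply/eqmodP. Qed.

(** If [x] is not in [Gam * K], then [x * k^-1] avoids the closed set [Gam] for
    each [k] in [K].  By compactness of [K] one neighbourhood of [x] serves all
    [k] at once, so [Gam * K], which is the preimage of the image of [K], is
    closed. *)
Lemma closed_right_coset (K : set G) :
  compact K -> closed (right_coset Gam @` K).
Proof.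
move=> cK; rewrite -[X in closed X]setCK; apply: open_closedC.
suff : open (right_coset Gam @^-1` (~` (right_coset Gam @` K))) by [].
rewrite openE => x /= xK; rewrite /interior.
have /compact_near_coveringP/(_ G (nbhs x)
  (fun y k => ~ (Gam : set G) (y * k^-1)) _) near_K := cK.
have : \forall y \near x, K `<=` (fun k => ~ (Gam : set G) (y * k^-1)).
  apply: near_K => k Kk.
  have xk : ~ (Gam : set G) (x * k^-1).
    by move=> /mem_set/right_cosetP xk; apply: xK; exists k.
  have cont : {for (k, x), continuous (fun p : G * G => p.2 * p.1^-1)}.
    apply: (@continuous_comp _ _ _ (fun p : G * G => (p.2, p.1^-1))
      (fun p : G * G => p.1 * p.2)); last exact: mulg_continuous.
    apply: cvg_pair; first exact: cvg_snd.
    by apply: (continuous_comp cvg_fst); exact: invg_continuous.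
  apply: (cont (~` Gam)).
  by apply: open_nbhs_nbhs; split => //; exact/closed_openC/csg_closed.
apply: filterS => y yK [k Kk] /esym/right_cosetP /set_mem.
exact: yK.
Qed.

End subgroup_cosets.

(** * Factorization of the group along the section *)

Lemma measurable_mulg (G : topologicalGroupType) d (S : measurableType d)
    (f g : S -> G) :
  @second_countable G ->
  measurable_fun [set: S] (f : S -> borel G) ->
  measurable_fun [set: S] (g : S -> borel G) ->
  measurable_fun [set: S] ((fun x => f x * g x) : S -> borel G).
Proof.
move=> scG mf mg; apply: measurable_fun_borel => U oU.
have mW : measurable ((fun p : G * G => p.1 * p.2) @^-1` U :
    set (borel G * borel G)).
  apply: open_prod_measurable => //.
  by apply: open_comp oU => p _; exact: mulg_continuous.
rewrite -[X in measurable X]setTI.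
exact: (measurable_fun_pair mf mg measurableT mW).
Qed.

Lemma measurable_subgroup (G : topologicalGroupType) (Gam : closedSubgroup G)
    d (S : measurableType d) (f : S -> subgroup Gam) :
  measurable_fun [set: S] ((fun x => val (f x)) : S -> borel G) ->
  measurable_fun [set: S] (f : S -> borel (subgroup Gam)).
Proof.
move=> mf; apply: measurable_fun_borel => _ [V oV <-].
rewrite -[X in measurable X]setTI.
by apply: mf => //; exact: sub_sigma_algebra.
Qed.

Section right_section.
Context {G : topologicalGroupType} (Gam : closedSubgroup G).
Variable tau : left_cosets Gam -> G.
Hypothesis tau_section : borel_section tau.

Lemma right_sectionK : cancel (right_section tau) (right_coset Gam).
Proof.
move=> q; have qE : right_coset Gam (repr q) = q by exact: reprK.
rewrite -{1}qE right_sectionE -[RHS]qE.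
have [_ /(_ (repr q)^-1)[g Gg <-] _] := tau_section.
apply/right_cosetP.
by rewrite invgM invgK mulgK; exact/(group_closedV (csg_group Gam))/mem_set.
Qed.

Lemma right_cosetM (xi : subgroup Gam) (x : G) :
  right_coset Gam (val xi * x) = right_coset Gam x.
Proof. by apply/right_cosetP; rewrite mulgK; exact: valP. Qed.

Lemma right_section_mem (x : G) :
  x * (right_section tau (right_coset Gam x))^-1 \in (Gam : set G).
Proof. by apply/right_cosetP; rewrite right_sectionK. Qed.

(** The section [gamma] is [tau] conjugated by inversion, and inversion induces
    a continuous map from right cosets to left cosets. *)
Lemma measurable_right_section :
  measurable_fun [set: borel (right_cosets Gam)]
    (right_section tau : _ -> borel G).
Proof.
have [mtau _ _] := tau_section.
pose inv_coset (q : right_cosets Gam) := left_coset Gam (repr q)^-1.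
have cinv : continuous inv_coset.
  apply: (@repr_comp_continuous G _ _ (fun x => left_coset Gam x^-1)).
    move=> x; apply: (@continuous_comp _ _ _ (fun x : G => x^-1)).
      exact: invg_continuous.
    exact: left_coset_continuous.
  move=> x y /eqP/eqmodP xy; apply/eqP/eqmodP.
  by rewrite /= /left_coset_eq invgK.
apply: (@measurableT_comp _ _ _ (borel (right_cosets Gam)) (borel G) (borel G)
  (fun x : G => x^-1)).
  by apply: continuous_measurable_borel; exact: invg_continuous.
apply: (measurableT_comp mtau).
exact: continuous_measurable_borel cinv.
Qed.

Definition coset_mul (p : subgroup Gam * right_cosets Gam) : G :=
  val p.1 * right_section tau p.2.

Definition coset_split (x : G) : subgroup Gam * right_cosets Gam :=
  (exist (fun y => y \in (Gam : set G)) _ (right_section_mem x),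
   right_coset Gam x).

Lemma coset_mulK : cancel coset_mul coset_split.
Proof.
move=> [xi q]; rewrite /coset_mul /coset_split /=.
have qE : right_coset Gam (val xi * right_section tau q) = q.
  by rewrite right_cosetM right_sectionK.
by congr (_, _) => //; apply: val_inj; rewrite /= qE mulgK.
Qed.

Lemma coset_splitK : cancel coset_split coset_mul.
Proof. by move=> x; rewrite /coset_mul /= mulgVK. Qed.

Hypothesis scG : @second_countable G.

Lemma measurable_coset_mul :
  measurable_fun [set: borel (subgroup Gam) * borel (right_cosets Gam)]
    (coset_mul : _ -> borel G).
Proof.
apply: measurable_mulg => //.
  apply: measurableT_comp measurable_fst.
  by apply: continuous_measurable_borel; exact: subgroup_val_continuous.
by apply: measurableT_comp measurable_snd; exact: measurable_right_section.
Qed.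

Lemma measurable_coset_split :
  measurable_fun [set: borel G]
    (coset_split : _ -> borel (subgroup Gam) * borel (right_cosets Gam)).
Proof.
have m_coset : measurable_fun [set: borel G]
    (right_coset Gam : borel G -> borel (right_cosets Gam)).
  by apply: continuous_measurable_borel; exact: right_coset_continuous.
apply: measurable_fun_pair => //; apply: measurable_subgroup.
apply: measurable_mulg => //.
apply: (@measurableT_comp _ _ _ (borel G) (borel G) (borel G)
  (fun x : G => x^-1)).
  by apply: continuous_measurable_borel; exact: invg_continuous.
exact: measurableT_comp measurable_right_section m_coset.
Qed.

End right_section.

(** * Sigma-finiteness on the subgroup and on the quotient *)

Section sigma_finiteness.
Context (R : realType) (G : topologicalGroupType) (Gam : closedSubgroup G).
Hypotheses (scG : @second_countable G) (lcG : locally_compact [set: G]).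

Lemma subgroup_sigma_finite
    (mu : {measure set (borel (subgroup Gam)) -> \bar R}) :
  regular_borel mu -> sigma_finite [set: borel (subgroup Gam)] mu.
Proof.
have [K [GK cK clK]] := countable_compact_cover _ scG lcG.
move=> mu_reg.
apply: (compact_cover_sigma_finite _ _ mu (fun n => val @^-1` K n)) => //.
- by rewrite -preimage_bigcup -GK.
- by move=> n; exact: compact_subgroup.
- by move=> n; apply: closed_comp => // x _; exact: subgroup_val_continuous.
Qed.

Lemma right_cosets_sigma_finite
    (mu : {measure set (borel (right_cosets Gam)) -> \bar R}) :
  regular_borel mu -> sigma_finite [set: borel (right_cosets Gam)] mu.
Proof.
have [K [GK cK clK]] := countable_compact_cover _ scG lcG.
move=> mu_reg.
apply: (compact_cover_sigma_finite _ _ mu (fun n => right_coset Gam @` K n))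
  => //.
- rewrite -image_bigcup -GK; apply/seteqP; split => // q _.
  by exists (repr q) => //; exact: reprK.
- move=> n; apply: continuous_compact => //.
  by apply: continuous_subspaceT; exact: right_coset_continuous.
- by move=> n; exact: closed_right_coset.
Qed.

End sigma_finiteness.

(** * The isomorphism *)

Theorem theorem3p6 (R : realType) (G : topologicalGroupType)
    (Gam : closedSubgroup G)
    (G_second_countable : @second_countable G)
    (G_locally_compact : locally_compact [set: G])
    (G_hausdorff : hausdorff_space G)
    (mu_G : {measure set (borel G) -> \bar R})
    (mu_Gam : {measure set (borel (subgroup Gam)) -> \bar R})
    (mu_G_haar : left_haar mu_G)
    (mu_Gam_haar : left_haar mu_Gam)
    (tau : left_cosets Gam -> G)
    (tau_section : borel_section tau)
    (mu_Q : {measure set (borel (right_cosets Gam)) -> \bar R})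
    (mu_Q_regular : regular_borel mu_Q)
    (mu_Q_quotient : forall f : G -> R,
      mu_G.-integrable [set: borel G] (EFin \o f) ->
      \int[mu_G]_x (f x)%:E =
      \int[mu_Q]_q \int[mu_Gam]_xi
        (f (val (xi : subgroup Gam) * right_section tau q)%g)%:E) :
  measure_space_iso (mu_Gam \x mu_Q)%E mu_G
    (fun p : borel (subgroup Gam) * borel (right_cosets Gam) =>
       val (p.1 : subgroup Gam) * right_section tau p.2).
Proof.
have [mu_G_reg _ _] := mu_G_haar; have [mu_Gam_reg _ _] := mu_Gam_haar.
have [K [GK cK clK]] :=
  countable_compact_cover _ G_second_countable G_locally_compact.
have G_fin : sigma_finite [set: borel G] mu_G.
  exact: compact_cover_sigma_finite GK cK clK.
have Gam_fin : sigma_finite [set: borel (subgroup Gam)] mu_Gam.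
  exact: subgroup_sigma_finite.
have Q_fin : sigma_finite [set: borel (right_cosets Gam)] mu_Q.
  exact: right_cosets_sigma_finite.
have mT := measurable_coset_mul _ _ tau_section G_second_countable.
split; first exact: mT.
  exists (coset_split Gam tau tau_section); split.
  - exact: coset_mulK.
  - exact: coset_splitK.
  - exact: measurable_coset_split.
pose P : {measure set (borel (subgroup Gam) * borel (right_cosets Gam))
    -> \bar R} := (mu_Gam \x sigma_finite_pack _ _ _ mu_Q Q_fin)%E.
apply: (preimage_measure_eq_sigma_finite _ _ _ _ _ P mu_G _ mT G_fin).
move=> A mA A_fin.
have mTA : measurable (coset_mul Gam tau @^-1` A :
    set (borel (subgroup Gam) * borel (right_cosets Gam))).
  by rewrite -[X in measurable X]setTI; exact: mT.
(* Both sides become integrals over the quotient, compared section by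
   section. *)
rewrite [LHS]product_measure1_ysection //.
transitivity (\int[mu_G]_x (\1_A x)%:E)%E; last first.
  by rewrite integral_indic // setIT.
rewrite mu_Q_quotient; last first.
  apply/integrableP; split; first exact/measurable_realfun.measurable_EFinP.
  rewrite (eq_integral (fun x => (\1_A x)%:E)); last first.
    by move=> x _; rewrite gee0_abs // lee_fin.
  by rewrite integral_indic // setIT.
apply: eq_integral => q _.
rewrite -[in LHS](setIT (ysection _ q)) -integral_indic //; last first.
  exact: measurable_ysection.
by apply: eq_integral => xi _; rewrite !indicE mem_ysection.
Qed.
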